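(* Consider the spin-spin problem, i.e. the system for $(\theta_1(t),\theta_2(t))$ given for $j=1,2$ by $$\begin{aligned}0=\ \ddot\theta_j+\frac{\lambda_j}{2}\Bigg\{&\left(\frac{a}{r(t;e)}\right)^{3}\sin(2\theta_j-2f(t;e))\\&+\left(\frac{a}{r(t;e)}\right)^{5}\Bigg[\frac54\left(\hat q_{3-j}+\frac57\hat q_j\right)\sin(2\theta_j-2f(t;e))+\frac{25}{8}\lambda_j\sigma_j\sin(4\theta_j-4f(t;e))\\&\quad+\lambda_{3-j}\sigma_{3-j}\left(\frac38\sin(2\theta_j-2\theta_{3-j})+\frac{35}{8}\sin(2\theta_{3-j}+2\theta_j-4f(t;e))\right)\Bigg]\Bigg\},\end{aligned}$$ with all functions, parameters and terminology as defined in the context. The following statements hold. (i) Let $m_1,m_2\in\mathbb Z$ and $n\in\mathbb Z\setminus\{0\}$. Being an $R_{\alpha,\beta_1,\beta_2}$-symmetric orbit (for some $(\alpha,\beta_1,\beta_2)\in\pi\mathbb Z\times\frac{\pi}{2}\mathbb Z\times\frac{\pi}{2}\mathbb Z$) associated to a standard $(m_1:n,m_2:n)$ spin-spin resonance is equivalent, up to the identifications of solutions described in the context, to being a solution that satisfies the Dirichlet conditions $$\theta_j(\alpha)=\beta_j,\qquad \theta_j(\alpha+n\pi)=\beta_j+m_j\pi,\qquad j=1,2,$$ with $\alpha\in\{0,\pi\}$ and $\beta_j\in\{0,\frac{\pi}{2}\}$ (eight combinations). Moreover, such a solution satisfies the symmetry property $\theta_j(t)=2\beta_j-\theta_j(2\alpha-t)$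 for all $t$ and $j=1,2$. (ii) Let $m_1,m_2\in\mathbb Z$. Up to the same identifications, there are four independent types (i.e. not identified with each other) of $R_{\alpha,\beta_1,\beta_2}$-symmetric orbits representing a balanced $(m_1:2,m_2:2)$ spin-spin resonance, and they are given by the solutions satisfying $$\text{Type }(\beta_1,\beta_2):\qquad \theta_j(0)=\beta_j,\quad \theta_j(\pi)=\beta_j+\frac{m_j\pi}{2},\qquad j=1,2,$$ with $\beta_j\in\{0,\frac{\pi}{2}\}$. Moreover, the corresponding symmetry relation is $\theta_j(t)=2\beta_j-\theta_j(-t)$ for all $t$ and $j=1,2$.
   Context: **Keplerian orbit.** Fix $a>0$ and $e\in[0,1)$. For $t\in\mathbb R$ let $u=u(t)$ be the unique solution of Kepler's equation $t=u-e\sin u$. Define $r(t;e)=a(1-e\cos u)$ and let $f(t;e)$ be the continuous function of $t$ with $f(0;e)=0$ and $r\exp(if)=a(\cos u-e+i\sqrt{1-e^2}\,\sin u)$. **Parameters.** For $j=1,2$, the ellipsoid $\mathcal E_j$ has mass $M_j>0$ and principal moments of inertia $\mathcal A_j\le\mathcal B_j\le\mathcal C_j$, with units such that $M_1+M_2=1$, $\mathcal C_1+\mathcal C_2=1$ and orbital period $2\pi$. Put $\mu=M_1M_2$, $d_j=\mathcal B_j-\mathcal A_j$, $q_j=2\mathcal C_j-\mathcal B_j-\mathcal A_j$, and $$\lambda_j=3\frac{\mu}{M_j}\frac{d_j}{\mathcal C_j},\qquad \sigma_j=\frac13\frac{\mathcal C_j}{\mu a^2},\qquad \hat q_j=\frac{q_j}{M_ja^2}.$$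 These are real constants in the equations. The angle $\theta_j$ gives the orientation of $\mathcal E_j$, and $p_j=\mathcal C_j\dot\theta_j$. **Reversing symmetries and symmetric orbits.** The system is written as an autonomous first-order system $\dot{\mathbf x}=\mathbf F(\mathbf x)$ for $\mathbf x=(t,\theta_1,\theta_2,p_1,p_2)\in\mathbb R^5$, with $\dot t=1$, $\dot\theta_j=p_j/\mathcal C_j$, and $\dot p_j=\mathcal C_j\ddot\theta_j$ where $\ddot\theta_j$ is expressed through the system. For $(\alpha,\beta_1,\beta_2)\in\pi\mathbb Z\times\frac{\pi}{2}\mathbb Z\times\frac{\pi}{2}\mathbb Z$ let $$R_{\alpha,\beta_1,\beta_2}(t,\theta_1,\theta_2,p_1,p_2)=(2\alpha-t,\,2\beta_1-\theta_1,\,2\beta_2-\theta_2,\,p_1,\,p_2).$$ The orbit of $\mathbf x_0$ is $o(\mathbf x_0)=\{\mathbf x(s;\mathbf x_0): s\in\mathbb R\}$, where $\mathbf x(s;\mathbf x_0)$ is the solution with $\mathbf x(0;\mathbf x_0)=\mathbf x_0$. It is called $R$-symmetric if $R(o(\mathbf x_0))=o(\mathbf x_0)$. **Resonances.** A solution $(\theta_1,\theta_2)$ is in a standard $(m_1:n_1,m_2:n_2)$ spin-spin resonance ($m_j\in\mathbb Z$, $n_j\in\mathbb Z\setminus\{0\}$) if $\theta_j(t+2\pi n_j)=\theta_j(t)+2\pi m_j$ for all $t$ and $j=1,2$. It is in a balanced $(m_1:2,m_2:2)$ spin-spin resonance ($m_j\in\mathbb Z$) if $\theta_j(t+2\pi)=\theta_j(t)+m_j\pi$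 for all $t$ and $j=1,2$. **Identifications.** The vector field $\mathbf F$ is $2\pi$-periodic in $t$ and $\pi$-periodic in each of $\theta_1,\theta_2$ (the mirror symmetries of the ellipsoids make the angle $\theta_j$ equivalent to $\theta_j+k_j\pi$, $k_j\in\mathbb Z$). Accordingly, two solutions are identified (equivalent) if one is obtained from the other by $(\theta_1(t),\theta_2(t))\mapsto(\theta_1(t+2\pi l)+k_1\pi,\ \theta_2(t+2\pi l)+k_2\pi)$ with $k_1,k_2,l\in\mathbb Z$. *)

(* Defs.v *)
From Stdlib Require Import Reals ZArith.
From Coquelicot Require Import Coquelicot.
Open Scope R_scope.

Inductive body : Set := E1 | E2.

(* The index 3 - j. *)
Definition other (j : body) : body :=
  match j with E1 => E2 | E2 => E1 end.

Record params : Type := Params {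
  sma : R;               (* semi-major axis a *)
  ecc : R;               (* eccentricity e *)
  mass : body -> R;      (* M_j *)
  momA : body -> R;      (* principal moments of inertia A_j <= B_j <= C_j *)
  momB : body -> R;
  momC : body -> R
}.

Definition admissible (P : params) : Prop :=
  0 < sma P /\
  0 <= ecc P < 1 /\
  (forall j, 0 < mass P j) /\
  (forall j, momA P j <= momB P j <= momC P j) /\
  (forall j, 0 < momC P j) /\
  mass P E1 + mass P E2 = 1 /\
  momC P E1 + momC P E2 = 1.

Definition mu (P : params) : R := mass P E1 * mass P E2.

Definition dd (P : params) (j : body) : R := momB P j - momA P j.

Definition qq (P : params) (j : body) : R :=
  2 * momC P j - momB P j - momA P j.

Definition lambda (P : params) (j : body) : R :=
  3 * (mu P / mass P j) * (dd P j / momC P j).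

Definition sigma (P : params) (j : body) : R :=
  1 / 3 * (momC P j / (mu P * sma P ^ 2)).

Definition qhat (P : params) (j : body) : R :=
  qq P j / (mass P j * sma P ^ 2).

(* [u] is the eccentric anomaly, [r] the radius and [f] the true anomaly, as
   functions of time; these conditions determine the three functions uniquely.
   The last one is r exp(i f) = a (cos u - e + i sqrt(1 - e^2) sin u) in C. *)
Definition kepler_orbit (P : params) (u r f : R -> R) : Prop :=
  (forall t, t = u t - ecc P * sin (u t)) /\
  (forall t, r t = sma P * (1 - ecc P * cos (u t))) /\
  (forall t, continuous f t) /\
  f 0 = 0 /\
  (forall t,
     Cmult (RtoC (r t)) (cos (f t), sin (f t)) =
     Cmult (RtoC (sma P))
           (cos (u t) - ecc P, sqrt (1 - ecc P ^ 2) * sin (u t))).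

(* The term (lambda_j / 2) { ... } of the equation for theta_j, at time [t]
   and angles [th]. *)
Definition torque (P : params) (r f : R -> R) (j : body) (t : R)
    (th : body -> R) : R :=
  let k := other j in
  lambda P j / 2 *
  ((sma P / r t) ^ 3 * sin (2 * th j - 2 * f t)
   + (sma P / r t) ^ 5 *
     (5 / 4 * (qhat P k + 5 / 7 * qhat P j) * sin (2 * th j - 2 * f t)
      + 25 / 8 * lambda P j * sigma P j * sin (4 * th j - 4 * f t)
      + lambda P k * sigma P k *
        (3 / 8 * sin (2 * th j - 2 * th k)
         + 35 / 8 * sin (2 * th k + 2 * th j - 4 * f t)))).

(* Differentiability of [theta j] is required separately because
   [ex_derive_n g 2 t] only asserts that the total function [Derive g] is
   differentiable at [t]. *)
Definition spin_spin_solution (P : params) (r f : R -> R)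
    (theta : body -> R -> R) : Prop :=
  forall j t,
    ex_derive (theta j) t /\
    ex_derive_n (theta j) 2 t /\
    0 = Derive_n (theta j) 2 t + torque P r f j t (fun k => theta k t).

(* Phase points (t, theta_1, theta_2, p_1, p_2). *)
Definition state : Type := (R * R * R * R * R)%type.

Definition angles (th1 th2 : R) (j : body) : R :=
  match j with E1 => th1 | E2 => th2 end.

Definition vector_field (P : params) (r f : R -> R) (x : state) : state :=
  let '(t, th1, th2, p1, p2) := x in
  (1,
   p1 / momC P E1,
   p2 / momC P E2,
   momC P E1 * - torque P r f E1 t (angles th1 th2),
   momC P E2 * - torque P r f E2 t (angles th1 th2)).

Definition integral_curve (P : params) (r f : R -> R) (x : R -> state) : Prop :=
  forall s, is_derive x s (vector_field P r f (x s)).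

Definition orbit (P : params) (r f : R -> R) (x0 : state) (y : state) : Prop :=
  exists x : R -> state,
    integral_curve P r f x /\ x 0 = x0 /\ exists s, y = x s.

Definition reversor (alpha : R) (beta : body -> R) (x : state) : state :=
  let '(t, th1, th2, p1, p2) := x in
  (2 * alpha - t, 2 * beta E1 - th1, 2 * beta E2 - th2, p1, p2).

Definition symmetric_orbit (P : params) (r f : R -> R) (alpha : R)
    (beta : body -> R) (x0 : state) : Prop :=
  forall y,
    (exists z, orbit P r f x0 z /\ y = reversor alpha beta z) <->
    orbit P r f x0 y.

(* The phase point at time [t] of a motion [theta], with p_j = C_j theta_j'. *)
Definition phase_point (P : params) (theta : body -> R -> R) (t : R) : state :=
  (t, theta E1 t, theta E2 t,
   momC P E1 * Derive (theta E1) t, momC P E2 * Derive (theta E2) t).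

(* Symmetry for some (alpha, beta_1, beta_2) in pi Z x (pi/2) Z x (pi/2) Z.
   The initial time is immaterial: all phase points of a solution lie on the
   same orbit. *)
Definition has_symmetric_orbit (P : params) (r f : R -> R)
    (theta : body -> R -> R) : Prop :=
  exists (a : Z) (b : body -> Z),
    symmetric_orbit P r f (IZR a * PI) (fun j => IZR (b j) * (PI / 2))
      (phase_point P theta 0).

Definition standard_resonance (m n : body -> Z) (theta : body -> R -> R)
    : Prop :=
  forall j t,
    theta j (t + 2 * PI * IZR (n j)) = theta j t + 2 * PI * IZR (m j).

Definition balanced_resonance (m : body -> Z) (theta : body -> R -> R) : Prop :=
  forall j t, theta j (t + 2 * PI) = theta j t + IZR (m j) * PI.

Definition identified (theta theta' : body -> R -> R) : Prop :=
  exists (l : Z) (k : body -> Z), forall j t,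
    theta' j t = theta j (t + 2 * PI * IZR l) + IZR (k j) * PI.

Definition dirichlet (m : body -> Z) (n : Z) (alpha : R) (beta : body -> R)
    (theta : body -> R -> R) : Prop :=
  forall j,
    theta j alpha = beta j /\
    theta j (alpha + IZR n * PI) = beta j + IZR (m j) * PI.

Definition balanced_type (m : body -> Z) (beta : body -> R)
    (theta : body -> R -> R) : Prop :=
  forall j,
    theta j 0 = beta j /\
    theta j PI = beta j + IZR (m j) * PI / 2.

(* Main.v *)
(** The torque is odd under [(t, theta) -> (2 a pi - t, b pi - theta)] because
    the radius is even and the true anomaly odd about each multiple of [pi];
    hence reflecting a solution gives a solution.  The torque is Lipschitz in
    the angles uniformly in time, so Gronwall gives uniqueness.  A reflected
    solution always has the same velocity as the original one at the centre
    [a pi], so a solution is symmetric about [a pi] if and only if it takes the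
    value [b pi / 2] there: a Dirichlet problem is exactly a pair of symmetries.
    The composition of two symmetries is the resonance relation, and a symmetry
    composed with the resonance relation is the second symmetry. *)

From Stdlib Require Import Reals ZArith Lra Lia.
From Coquelicot Require Import Coquelicot.
Require Import Defs.
Open Scope R_scope.

(** * Periodicity and Lipschitz bound for the trigonometric functions *)

Lemma sin_add_2kPI (x : R) (k : Z) : sin (x + 2 * (IZR k * PI)) = sin x.
Proof.
  assert (Hs : sin (IZR k * PI) = 0) by (apply sin_eq_0_1; now exists k).
  rewrite sin_plus, cos_2a_sin, sin_2a, Hs; ring.
Qed.

Lemma cos_add_2kPI (x : R) (k : Z) : cos (x + 2 * (IZR k * PI)) = cos x.
Proof.
  assert (Hs : sin (IZR k * PI) = 0) by (apply sin_eq_0_1; now exists k).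
  rewrite cos_plus, cos_2a_sin, sin_2a, Hs; ring.
Qed.

Lemma sin_lipschitz (x y : R) : Rabs (sin x - sin y) <= Rabs (x - y).
Proof.
  rewrite <- (Rmult_1_l (Rabs (x - y))).
  apply (bounded_variation sin cos 1 y x); intros t _; split.
  - apply is_derive_sin.
  - apply Rabs_le, COS_bound.
Qed.

(** * Gronwall estimates *)

(** [E s * exp (c * s)] is nonincreasing for [c = - K] and nondecreasing for [c = K]. The mean value
    theorem from [t0], where it vanishes, makes it nonpositive at [t]: the first choice serves
    [t >= t0], the second [t < t0]. *)
Lemma gronwall_zero (E dE : R -> R) (K t0 : R) :
  (forall t, is_derive E t (dE t)) ->
  (forall t, 0 <= E t) ->
  (forall t, Rabs (dE t) <= K * E t) ->
  E t0 = 0 ->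
  forall t, E t = 0.
Proof.
  intros HE Hpos Hbd H0 t.
  assert (Hexp : forall (c s : R),
    is_derive (fun s => E s * exp (c * s)) s ((dE s + c * E s) * exp (c * s))).
  { intros c s; auto_derive.
    - now exists (dE s).
    - change (Derive (fun x => E x) s) with (Derive E s).
      rewrite (is_derive_unique _ _ _ (HE s)); ring. }
  assert (Hmvt : forall c, exists s,
    E t * exp (c * t) = (dE s + c * E s) * exp (c * s) * (t - t0)).
  { intros c.
    destruct (MVT_gen (fun s => E s * exp (c * s)) t0 t
      (fun s => (dE s + c * E s) * exp (c * s))) as [s [_ Hs]].
    - intros s _; apply Hexp.
    - intros s _. apply continuity_pt_filterlim.
      apply (ex_derive_continuous (fun s => E s * exp (c * s))).
      eexists; apply Hexp.
    - exists s. rewrite H0 in Hs. lra. }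
  assert (Hle : forall c, (forall s, (dE s + c * E s) * (t - t0) <= 0) -> E t = 0).
  { intros c Hc. destruct (Hmvt c) as [s Hs].
    pose proof (exp_pos (c * t)); pose proof (exp_pos (c * s)).
    specialize (Hc s); specialize (Hpos t). nra. }
  destruct (Rle_dec t0 t) as [H | H].
  - apply (Hle (- K)); intros s.
    specialize (Hbd s). apply Rabs_le_between in Hbd. nra.
  - apply (Hle K); intros s.
    specialize (Hbd s). apply Rabs_le_between in Hbd. nra.
Qed.

(** The sum of squares [E] of positions and velocities satisfies [|E'| <= (1 + 2 K) E]: the products
    [x y] contribute the 1, the products [y T] the [2 K]. *)
Lemma second_order_gronwall (x y T : body -> R -> R) (K t0 : R) :
  (forall j (t : R), is_derive (x j) t (y j t)) ->
  (forall j (t : R), is_derive (y j) t (T j t)) ->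
  0 <= K ->
  (forall j t, Rabs (T j t) <= K * (Rabs (x E1 t) + Rabs (x E2 t))) ->
  (forall j, x j t0 = 0 /\ y j t0 = 0) ->
  forall j t, x j t = 0 /\ y j t = 0.
Proof.
  intros Hx Hy HK HT H0.
  set (E := fun t => x E1 t ^ 2 + x E2 t ^ 2 + y E1 t ^ 2 + y E2 t ^ 2).
  assert (HE : forall t, E t = 0).
  { apply (gronwall_zero E
      (fun t => 2 * (x E1 t * y E1 t + x E2 t * y E2 t
                     + y E1 t * T E1 t + y E2 t * T E2 t))
      (1 + 2 * K) t0).
    - intros t. unfold E. auto_derive.
      + repeat (apply conj || exact I);
          [exists (y E1 t); apply Hx | exists (y E2 t); apply Hx
          | exists (T E1 t); apply Hy | exists (T E2 t); apply Hy].
      + assert (Ex : forall j, Derive (fun s => x j s) t = y j t)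
          by (intros; apply is_derive_unique, Hx).
        assert (Ey : forall j, Derive (fun s => y j s) t = T j t)
          by (intros; apply is_derive_unique, Hy).
        rewrite !Ex, !Ey. ring.
    - intros t. unfold E.
      repeat apply Rplus_le_le_0_compat; apply pow2_ge_0.
    - intros t. unfold E.
      (* From [|y| |x_i| <= (y^2 + x_i^2) / 2], summed over the two bodies. *)
      assert (Hp : forall j, Rabs (y j t * T j t) <=
        K * (y j t ^ 2 + (x E1 t ^ 2 + x E2 t ^ 2) / 2)).
      { intros j. rewrite Rabs_mult, <- (pow2_abs (y j t)),
          <- (pow2_abs (x E1 t)), <- (pow2_abs (x E2 t)).
        apply Rle_trans with
          (Rabs (y j t) * (K * (Rabs (x E1 t) + Rabs (x E2 t)))).
        - apply Rmult_le_compat_l; [apply Rabs_pos | apply HT].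
        - rewrite <- Rmult_assoc, (Rmult_comm _ K), Rmult_assoc.
          apply Rmult_le_compat_l; [easy |].
          pose proof (pow2_ge_0 (Rabs (y j t) - Rabs (x E1 t))).
          pose proof (pow2_ge_0 (Rabs (y j t) - Rabs (x E2 t))). lra. }
      assert (L1 := Hp E1). assert (L2 := Hp E2).
      apply Rabs_le_between in L1, L2.
      pose proof (pow2_ge_0 (x E1 t - y E1 t)).
      pose proof (pow2_ge_0 (x E1 t + y E1 t)).
      pose proof (pow2_ge_0 (x E2 t - y E2 t)).
      pose proof (pow2_ge_0 (x E2 t + y E2 t)).
      apply Rabs_le. split; lra.
    - unfold E. destruct (H0 E1) as [-> ->], (H0 E2) as [-> ->]. ring. }
  intros j t. specialize (HE t). unfold E in HE.
  pose proof (pow2_ge_0 (x E1 t)); pose proof (pow2_ge_0 (x E2 t)).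
  pose proof (pow2_ge_0 (y E1 t)); pose proof (pow2_ge_0 (y E2 t)).
  destruct j; split; apply Rsqr_0_uniq; unfold Rsqr; lra.
Qed.

(** * Derivatives of curves in product spaces *)

Lemma is_derive_pair (U V : NormedModule R_AbsRing) (g : R -> U) (h : R -> V)
    (s : R) (dg : U) (dh : V) :
  is_derive g s dg -> is_derive h s dh ->
  is_derive (fun t => (g t, h t)) s (dg, dh).
Proof.
  intros Hg Hh.
  apply (filterdiff_ext_lin _
    (fun t : R => (scal t dg, scal t dh) : prod_NormedModule _ U V)).
  - apply (filterdiff_comp'_2 g h (fun a b => (a, b) : prod_NormedModule _ U V)
      s _ _ (fun a b => (a, b)) Hg Hh).
    (* Viewed on the product space, the pairing map is the identity. *)
    apply (filterdiff_ext (fun p : prod_NormedModule _ U V => p)).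
    + now intros [].
    + eapply filterdiff_ext_lin; [apply filterdiff_id | now intros []].
  - easy.
Qed.

Lemma is_derive_pair_inv (U V : NormedModule R_AbsRing)
    (g : R -> prod_NormedModule R_AbsRing U V) (s : R) (dg : U * V) :
  is_derive g s dg ->
  is_derive (fun t => fst (g t)) s (fst dg) /\
  is_derive (fun t => snd (g t)) s (snd dg).
Proof.
  intros Hg. split.
  - eapply filterdiff_ext_lin.
    + apply (filterdiff_comp' g fst s _ fst Hg), filterdiff_linear, is_linear_fst.
    + easy.
  - eapply filterdiff_ext_lin.
    + apply (filterdiff_comp' g snd s _ snd Hg), filterdiff_linear, is_linear_snd.
    + easy.
Qed.

(** * Reflection of the Kepler orbit and of the torque *)

(** Since sine is 1-Lipschitz, [|x - y| = e |sin x - sin y| <= e |x - y|] with [e < 1]. *)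
Lemma kepler_equation_injective (e x y : R) :
  0 <= e < 1 -> x - e * sin x = y - e * sin y -> x = y.
Proof.
  intros He H. pose proof (sin_lipschitz x y) as Hs.
  assert (Hxy : Rabs (x - y) = e * Rabs (sin x - sin y)).
  { rewrite <- (Rabs_pos_eq e) at 1 by easy. rewrite <- Rabs_mult.
    f_equal; lra. }
  pose proof (Rabs_pos (x - y)).
  destruct (Req_dec (x - y) 0) as [| Hn]; [lra |].
  apply Rabs_no_R0 in Hn. nra.
Qed.

Section Kepler.
Variables (P : params) (u r f : R -> R).
Hypotheses (hP : admissible P) (hK : kepler_orbit P u r f).

(** Both sides solve Kepler's equation at the reflected time. *)
Lemma eccentric_anomaly_reflect (a : Z) (t : R) :
  u (2 * (IZR a * PI) - t) = - u t + 2 * (IZR a * PI).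
Proof.
  destruct hP as (_ & he & _), hK as (Hu & _).
  apply (kepler_equation_injective (ecc P)); [easy |].
  rewrite <- Hu, sin_add_2kPI, sin_neg. pose proof (Hu t). lra.
Qed.

Lemma radius_reflect (a : Z) (t : R) : r (2 * (IZR a * PI) - t) = r t.
Proof.
  destruct hK as (_ & Hr & _).
  now rewrite !Hr, eccentric_anomaly_reflect, cos_add_2kPI, cos_neg.
Qed.

Lemma radius_lower (t : R) : sma P * (1 - ecc P) <= r t.
Proof.
  destruct hP as (ha & he & _), hK as (_ & Hr & _). rewrite Hr.
  pose proof (COS_bound (u t)). apply Rmult_le_compat_l; nra.
Qed.

Lemma radius_pos (t : R) : 0 < r t.
Proof.
  destruct hP as (ha & he & _). pose proof (radius_lower t). nra.
Qed.

(* [cos f] and [sin f] are read off the Kepler relation, so the continuity of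
   [f] plays no role. *)
Lemma true_anomaly_reflect (a : Z) (t : R) :
  cos (f (2 * (IZR a * PI) - t)) = cos (f t) /\
  sin (f (2 * (IZR a * PI) - t)) = - sin (f t).
Proof.
  destruct hK as (_ & _ & _ & _ & Hf).
  pose proof (Hf t) as H1. pose proof (Hf (2 * (IZR a * PI) - t)) as H2.
  rewrite radius_reflect, eccentric_anomaly_reflect, sin_add_2kPI,
    cos_add_2kPI, cos_neg, sin_neg in H2.
  unfold Cmult, RtoC in H1, H2; simpl in H1, H2.
  injection H1 as H1c H1s; injection H2 as H2c H2s.
  pose proof (radius_pos t).
  split; apply (Rmult_eq_reg_l (r t)); lra.
Qed.

(** [X] stands for the combination of angles in a sine of the torque; the multiples 2 and 4 of [f]
    are the ones occurring there. *)
Lemma sin_true_anomaly_reflect (a b : Z) (t X : R) :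
  sin (2 * (IZR b * PI) - X - 2 * f (2 * (IZR a * PI) - t)) =
    - sin (X - 2 * f t) /\
  sin (2 * (IZR b * PI) - X - 4 * f (2 * (IZR a * PI) - t)) =
    - sin (X - 4 * f t).
Proof.
  destruct (true_anomaly_reflect a t) as [Hc Hs].
  set (F := f (2 * (IZR a * PI) - t)) in *.
  (* Modulo [2 PI], [F] is [- f t], known here only through its sine and cosine; hence the
     double-angle formulas. The multiple 4 is obtained by applying this twice. *)
  assert (H2 : forall Y, sin (Y - 2 * F) = sin (Y + 2 * f t) /\
                         cos (Y - 2 * F) = cos (Y + 2 * f t)).
  { intros Y. rewrite sin_minus, cos_minus, sin_plus, cos_plus, !sin_2a,
      !cos_2a, Hc, Hs. split; ring. }
  split.
  - rewrite (proj1 (H2 _)), <- sin_neg, <- (sin_add_2kPI (- _) b). f_equal; ring.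
  - replace (2 * (IZR b * PI) - X - 4 * F)
      with ((2 * (IZR b * PI) - X - 2 * F) - 2 * F) by ring.
    rewrite (proj1 (H2 _)).
    replace (2 * (IZR b * PI) - X - 2 * F + 2 * f t)
      with ((2 * (IZR b * PI) - X + 2 * f t) - 2 * F) by ring.
    rewrite (proj1 (H2 _)), <- sin_neg, <- (sin_add_2kPI (- _) b). f_equal; ring.
Qed.

(** Every angle enters the sines with an even coefficient, so reflecting it about a multiple of
    [PI / 2] changes its sign up to a multiple of [2 PI]. Each sine is then odd, while the powers of
    [sma P / r t] are unchanged. *)
Lemma torque_reflect (a : Z) (b : body -> Z) (j : body) (t : R)
    (th : body -> R) :
  torque P r f j (2 * (IZR a * PI) - t)
    (fun k => 2 * (IZR (b k) * (PI / 2)) - th k) =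
  - torque P r f j t th.
Proof.
  unfold torque. rewrite radius_reflect.
  set (k := other j). set (F := f (2 * (IZR a * PI) - t)).
  replace (2 * (2 * (IZR (b j) * (PI / 2)) - th j) - 2 * F)
    with (2 * (IZR (b j) * PI) - 2 * th j - 2 * F) by field.
  replace (4 * (2 * (IZR (b j) * (PI / 2)) - th j) - 4 * F)
    with (2 * (IZR (2 * b j) * PI) - 4 * th j - 4 * F)
    by (rewrite mult_IZR; field).
  replace (2 * (2 * (IZR (b k) * (PI / 2)) - th k) +
           2 * (2 * (IZR (b j) * (PI / 2)) - th j) - 4 * F)
    with (2 * (IZR (b k + b j) * PI) - (2 * th k + 2 * th j) - 4 * F)
    by (rewrite plus_IZR; field).
  replace (2 * (2 * (IZR (b j) * (PI / 2)) - th j) -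
           2 * (2 * (IZR (b k) * (PI / 2)) - th k))
    with (- (2 * th j - 2 * th k) + 2 * (IZR (b j - b k) * PI))
    by (rewrite minus_IZR; field).
  unfold F. rewrite (proj1 (sin_true_anomaly_reflect _ _ _ _)),
    !(proj2 (sin_true_anomaly_reflect _ _ _ _)), sin_add_2kPI, sin_neg.
  ring.
Qed.

(** * Lipschitz dependence of the torque on the angles *)

(** One constant serves all times, so that Gronwall's estimate holds on the whole time axis. *)
Definition angle_lipschitz (G : R -> (body -> R) -> R) : Prop :=
  exists K, forall t th ph,
    Rabs (G t th - G t ph) <=
      K * (Rabs (th E1 - ph E1) + Rabs (th E2 - ph E2)).

Lemma angle_lipschitz_plus (G H : R -> (body -> R) -> R) :
  angle_lipschitz G -> angle_lipschitz H ->
  angle_lipschitz (fun t th => G t th + H t th).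
Proof.
  intros [K HG] [L HH]. exists (K + L). intros t th ph.
  replace (G t th + H t th - (G t ph + H t ph))
    with ((G t th - G t ph) + (H t th - H t ph)) by ring.
  eapply Rle_trans; [apply Rabs_triang |].
  specialize (HG t th ph); specialize (HH t th ph); lra.
Qed.

Lemma angle_lipschitz_scal (c : R -> R) (M : R) (G : R -> (body -> R) -> R) :
  (forall t, Rabs (c t) <= M) -> angle_lipschitz G ->
  angle_lipschitz (fun t th => c t * G t th).
Proof.
  intros Hc [K HG]. exists (M * K). intros t th ph.
  rewrite <- Rmult_minus_distr_l, Rabs_mult, Rmult_assoc.
  apply Rmult_le_compat; try apply Rabs_pos; auto.
Qed.

Lemma angle_lipschitz_const_scal (c : R) (G : R -> (body -> R) -> R) :
  angle_lipschitz G -> angle_lipschitz (fun t th => c * G t th).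
Proof.
  apply (angle_lipschitz_scal (fun _ => c) (Rabs c)). intros; apply Rle_refl.
Qed.

Lemma angle_lipschitz_sin (c1 c2 : R) (h : R -> R) (X : R -> (body -> R) -> R) :
  (forall t th, X t th = c1 * th E1 + c2 * th E2 - h t) ->
  angle_lipschitz (fun t th => sin (X t th)).
Proof.
  intros HX. exists (Rabs c1 + Rabs c2). intros t th ph.
  eapply Rle_trans; [apply sin_lipschitz |].
  replace (X t th - X t ph)
    with (c1 * (th E1 - ph E1) + c2 * (th E2 - ph E2)) by (rewrite !HX; ring).
  eapply Rle_trans; [apply Rabs_triang |]. rewrite !Rabs_mult.
  pose proof (Rabs_pos c1); pose proof (Rabs_pos c2).
  pose proof (Rabs_pos (th E1 - ph E1)); pose proof (Rabs_pos (th E2 - ph E2)).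
  nra.
Qed.

(** The radius never falls below its pericentre value [sma P * (1 - ecc P)]. *)
Lemma radius_ratio_bounded (n : nat) (t : R) :
  Rabs ((sma P / r t) ^ n) <= (1 / (1 - ecc P)) ^ n.
Proof.
  destruct hP as (ha & he & _).
  pose proof (radius_pos t); pose proof (radius_lower t).
  assert (0 <= sma P / r t) by (apply Rle_mult_inv_pos; lra).
  rewrite Rabs_pos_eq by now apply pow_le.
  apply pow_incr; split; [easy |].
  apply (Rmult_le_reg_r (r t * (1 - ecc P))); [nra |].
  replace (sma P / r t * (r t * (1 - ecc P))) with (sma P * (1 - ecc P))
    by (field; lra).
  replace (1 / (1 - ecc P) * (r t * (1 - ecc P))) with (r t) by (field; lra).
  easy.
Qed.

(** Each term is a bounded function of time multiplied by the sine of a linear form in the two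
    angles minus a multiple of [f t]; the triples of numbers in the proof are the coefficients of
    that form. *)
Lemma torque_lipschitz (j : body) : angle_lipschitz (torque P r f j).
Proof.
  assert (Hs : forall c1 c2 d, angle_lipschitz
    (fun t th => sin (c1 * th j + c2 * th (other j) - d * f t))).
  { intros c1 c2 d. destruct j; simpl.
    - apply (angle_lipschitz_sin c1 c2 (fun t => d * f t)); intros; ring.
    - apply (angle_lipschitz_sin c2 c1 (fun t => d * f t)); intros; ring. }
  assert (Hs' : forall (X : R -> (body -> R) -> R) c1 c2 d,
    (forall t th, X t th = c1 * th j + c2 * th (other j) - d * f t) ->
    angle_lipschitz (fun t th => sin (X t th))).
  { intros X c1 c2 d HX. destruct (Hs c1 c2 d) as [K HKs]. exists K.
    intros t th ph. rewrite !HX. apply HKs. }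
  unfold torque.
  apply angle_lipschitz_const_scal, angle_lipschitz_plus;
    (eapply angle_lipschitz_scal; [apply radius_ratio_bounded |]).
  - apply (Hs' _ 2 0 2); intros; ring.
  - apply angle_lipschitz_plus; [apply angle_lipschitz_plus |];
      apply angle_lipschitz_const_scal.
    + apply (Hs' _ 2 0 2); intros; ring.
    + apply (Hs' _ 4 0 4); intros; ring.
    + apply angle_lipschitz_plus; apply angle_lipschitz_const_scal.
      * apply (Hs' _ 2 (-2) 0); intros; ring.
      * apply (Hs' _ 2 2 4); intros; ring.
Qed.

(** * First-order form of the equations, reflection and uniqueness *)

(** Keeping the velocity as a separate function turns reflection and uniqueness into statements
    about first derivatives. *)
Definition motion (theta v : body -> R -> R) : Prop :=
  forall j (t : R),
    is_derive (theta j) t (v j t) /\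
    is_derive (v j) t (- torque P r f j t (fun k => theta k t)).

Lemma motion_of_solution (theta : body -> R -> R) :
  spin_spin_solution P r f theta -> motion theta (fun j => Derive (theta j)).
Proof.
  intros H j t. destruct (H j t) as (H1 & H2 & H3). split.
  - now apply Derive_correct.
  - replace (- _) with (Derive (Derive (theta j)) t)
      by (change (Derive_n (theta j) 2 t) with (Derive (Derive (theta j)) t) in H3;
          lra).
    now apply Derive_correct.
Qed.

Lemma motion_velocity (theta v : body -> R -> R) :
  motion theta v -> forall j t, Derive (theta j) t = v j t.
Proof. intros H j t. apply is_derive_unique, H. Qed.

Lemma solution_of_motion (theta v : body -> R -> R) :
  motion theta v -> spin_spin_solution P r f theta.
Proof.
  intros H j t. pose proof (motion_velocity _ _ H j) as Hv.
  assert (H2 : is_derive (Derive (theta j)) t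
                 (- torque P r f j t (fun k => theta k t))).
  { eapply is_derive_ext; [intros s; symmetry; apply Hv |]. apply (H j t). }
  repeat split.
  - exists (v j t); apply (H j t).
  - eexists; exact H2.
  - change (Derive_n (theta j) 2 t) with (Derive (Derive (theta j)) t).
    rewrite (is_derive_unique _ _ _ H2). ring.
Qed.

(** Pointwise equality suffices because the torque reads its angle argument only at [j] and
    [other j]. *)
Lemma solution_ext (theta phi : body -> R -> R) :
  (forall j t, theta j t = phi j t) ->
  spin_spin_solution P r f theta -> spin_spin_solution P r f phi.
Proof.
  intros E H.
  apply solution_of_motion with (v := fun j => Derive (theta j)).
  intros j t. destruct (motion_of_solution _ H j t) as [H1 H2]. split.
  - exact (is_derive_ext _ _ _ _ (E j) H1).
  - replace (torque P r f j t (fun k => phi k t))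
      with (torque P r f j t (fun k => theta k t)); [easy |].
    unfold torque. now rewrite !E.
Qed.

(** The velocity is changed in sign twice, by reversing time and by reversing the angle, hence keeps
    its sign; the acceleration changes sign once, as the torque does. *)
Lemma motion_reflect (a : Z) (b : body -> Z) (theta v : body -> R -> R) :
  motion theta v ->
  motion (fun j t => 2 * (IZR (b j) * (PI / 2)) - theta j (2 * (IZR a * PI) - t))
         (fun j t => v j (2 * (IZR a * PI) - t)).
Proof.
  intros H j t. destruct (H j (2 * (IZR a * PI) - t)) as [H1 H2].
  set (s := 2 * (IZR a * PI) - t) in *. split.
  - auto_derive; fold (Rminus (2 * (IZR a * PI)) t); fold s.
    + now exists (v j s).
    + change (Derive (fun x => theta j x) s) with (Derive (theta j) s).
      rewrite (motion_velocity _ _ H). ring.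
  - auto_derive; fold (Rminus (2 * (IZR a * PI)) t); fold s.
    + eexists; exact H2.
    + change (Derive (fun x => v j x) s) with (Derive (v j) s).
      rewrite (is_derive_unique _ _ _ H2).
      (* Reflection of time is an involution: reflecting [s] gives back [t]. *)
      pose proof (torque_reflect a b j s (fun k => theta k s)) as Ht.
      replace (2 * (IZR a * PI) - s) with t in Ht by (unfold s; ring).
      fold s. rewrite Ht. ring.
Qed.

Lemma motion_unique (theta v phi w : body -> R -> R) (t0 : R) :
  motion theta v -> motion phi w ->
  (forall j, theta j t0 = phi j t0 /\ v j t0 = w j t0) ->
  forall j t, theta j t = phi j t /\ v j t = w j t.
Proof.
  intros Hth Hph H0 j t.
  destruct (torque_lipschitz E1) as [K1 L1], (torque_lipschitz E2) as [K2 L2].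
  destruct (second_order_gronwall
    (fun j t => theta j t - phi j t) (fun j t => v j t - w j t)
    (fun j t => - torque P r f j t (fun k => theta k t)
                - - torque P r f j t (fun k => phi k t))
    (* The maximum with 0 is taken because [angle_lipschitz] does not ask for a nonnegative
       constant. *)
    (Rmax 0 (Rmax K1 K2)) t0) with (j := j) (t := t) as [Hx Hy].
  - intros i s. apply (is_derive_minus (theta i) (phi i));
      [apply (Hth i s) | apply (Hph i s)].
  - intros i s. apply (is_derive_minus (v i) (w i));
      [apply (Hth i s) | apply (Hph i s)].
  - apply Rmax_l.
  - intros i s.
    replace (- _ - - _) with
      (- (torque P r f i s (fun k => theta k s)
          - torque P r f i s (fun k => phi k s))) by ring.
    rewrite Rabs_Ropp.
    pose proof (Rmax_r 0 (Rmax K1 K2)).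
    pose proof (Rmax_l K1 K2); pose proof (Rmax_r K1 K2).
    pose proof (Rabs_pos (theta E1 s - phi E1 s)).
    pose proof (Rabs_pos (theta E2 s - phi E2 s)).
    destruct i; (eapply Rle_trans; [apply L1 || apply L2 |]);
      apply Rmult_le_compat_r; lra.
  - intros i. destruct (H0 i) as [-> ->]. split; ring.
  - simpl in Hx, Hy. split; lra.
Qed.

(** * Integral curves and orbits in phase space *)

Lemma phase_point_integral_curve (theta : body -> R -> R) :
  spin_spin_solution P r f theta -> integral_curve P r f (phase_point P theta).
Proof.
  intros H s. pose proof (motion_of_solution _ H) as Hm.
  destruct hP as (_ & _ & _ & _ & hC & _).
  assert (Hth : forall j, is_derive (theta j) s
                  (momC P j * Derive (theta j) s / momC P j)).
  { intros j. specialize (hC j).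
    replace (_ / _) with (Derive (theta j) s) by (field; lra). apply (Hm j s). }
  assert (Hp : forall j, is_derive (fun s => momC P j * Derive (theta j) s) s
                 (momC P j * - torque P r f j s (angles (theta E1 s) (theta E2 s)))).
  { intros j.
    replace (torque P r f j s (angles (theta E1 s) (theta E2 s)))
      with (torque P r f j s (fun k => theta k s)) by now destruct j.
    apply (is_derive_scal (Derive (theta j))). apply (Hm j s). }
  unfold phase_point, vector_field.
  repeat apply is_derive_pair; auto.
  apply (is_derive_id (K := R_AbsRing)).
Qed.

(** The time component has derivative 1 and starts at 0, so the curve parameter is time itself and
    the autonomous system reduces to the time-dependent one, with velocities [p_j / C_j]. *)
Lemma integral_curve_motion (x0 : R -> state) :
  integral_curve P r f x0 -> fst (fst (fst (fst (x0 0)))) = 0 ->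
  exists phi w, motion phi w /\ forall s,
    x0 s = (s, phi E1 s, phi E2 s, momC P E1 * w E1 s, momC P E2 * w E2 s).
Proof.
  intros H H0.
  destruct hP as (_ & _ & _ & _ & hC & _).
  pose proof (hC E1) as hC1; pose proof (hC E2) as hC2.
  set (T := fun s => fst (fst (fst (fst (x0 s))))).
  set (th1 := fun s => snd (fst (fst (fst (x0 s))))).
  set (th2 := fun s => snd (fst (fst (x0 s)))).
  set (p1 := fun s => snd (fst (x0 s))).
  set (p2 := fun s => snd (x0 s)).
  assert (Hx : forall s, x0 s = (T s, th1 s, th2 s, p1 s, p2 s)).
  { intros s. unfold T, th1, th2, p1, p2. now destruct (x0 s) as [[[[? ?] ?] ?] ?]. }
  assert (HD : forall s : R,
    is_derive T s 1 /\
    is_derive th1 s (p1 s / momC P E1) /\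
    is_derive th2 s (p2 s / momC P E2) /\
    is_derive p1 s (momC P E1 * - torque P r f E1 (T s) (angles (th1 s) (th2 s))) /\
    is_derive p2 s (momC P E2 * - torque P r f E2 (T s) (angles (th1 s) (th2 s)))).
  { intros s. specialize (H s). rewrite Hx in H. unfold vector_field in H.
    apply is_derive_pair_inv in H as [H D5].
    apply is_derive_pair_inv in H as [H D4].
    apply is_derive_pair_inv in H as [H D3].
    apply is_derive_pair_inv in H as [D1 D2].
    exact (conj D1 (conj D2 (conj D3 (conj D4 D5)))). }
  assert (HT : forall s, T s = s).
  { intros s.
    (* The variation of [T s - s] is bounded with constant 0, its derivative being 0. *)
    assert (Hb : Rabs ((T s - s) - (T 0 - 0)) <= 0 * Rabs (s - 0)).
    { apply (bounded_variation (fun s => T s - s) (fun _ => 1 - 1)).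
      intros t _. split.
      - apply (is_derive_minus T (fun s => s)); [apply HD |].
        apply (is_derive_id (K := R_AbsRing)).
      - rewrite Rminus_diag, Rabs_R0. lra. }
    change (T 0) with (fst (fst (fst (fst (x0 0))))) in Hb. rewrite H0 in Hb.
    rewrite Rmult_0_l in Hb. apply Rabs_le_between in Hb. lra. }
  exists (fun j => match j with E1 => th1 | E2 => th2 end),
         (fun j s => match j with E1 => p1 s / momC P E1 | E2 => p2 s / momC P E2 end).
  split.
  - intros j s. destruct (HD s) as (_ & D2 & D3 & D4 & D5). rewrite HT in D4, D5.
    assert (Hdiv : forall (p : R -> R) c tau, 0 < c -> is_derive p s (c * - tau) ->
              is_derive (fun s => p s / c) s (- tau)).
    { intros p c tau Hc Hp.
      replace (- tau) with (/ c * (c * - tau)) by (field; lra).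
      apply (is_derive_ext (fun s => / c * p s)); [intros; apply Rmult_comm |].
      now apply is_derive_scal. }
    destruct j; split; auto.
  - intros s. rewrite Hx, HT.
    replace (momC P E1 * (p1 s / momC P E1)) with (p1 s) by (field; apply Rgt_not_eq, hC).
    replace (momC P E2 * (p2 s / momC P E2)) with (p2 s) by (field; apply Rgt_not_eq, hC).
    reflexivity.
Qed.

(** [orbit] admits any integral curve through the initial point; uniqueness leaves only the one
    traced by [theta]. *)
Lemma orbit_phase_point (theta : body -> R -> R) (y : state) :
  spin_spin_solution P r f theta ->
  orbit P r f (phase_point P theta 0) y <-> exists s, y = phase_point P theta s.
Proof.
  intros H. split.
  - intros (x & Hx & Hx0 & s & ->). exists s.
    destruct (integral_curve_motion x Hx) as (phi & w & Hphi & E).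
    { now rewrite Hx0. }
    rewrite E in Hx0. injection Hx0 as X1 X2 X3 X4.
    destruct hP as (_ & _ & _ & _ & hC & _).
    apply Rmult_eq_reg_l in X3, X4; try (pose proof (hC E1); pose proof (hC E2); lra).
    assert (U : forall j t, phi j t = theta j t /\ w j t = Derive (theta j) t).
    { apply (motion_unique _ _ _ _ 0 Hphi (motion_of_solution _ H)).
      now intros []. }
    rewrite E. unfold phase_point.
    destruct (U E1 s) as [-> ->], (U E2 s) as [-> ->]. reflexivity.
  - intros [s ->]. exists (phase_point P theta).
    split; [now apply phase_point_integral_curve |]. split; [reflexivity | now exists s].
Qed.

(** * Symmetric orbits as symmetric motions *)

(** Integer indices turn the composition of symmetries into integer arithmetic. *)
Definition symmetric_motion (a : Z) (b : body -> Z) (theta : body -> R -> R) : Prop :=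
  forall j t,
    theta j t = 2 * (IZR (b j) * (PI / 2)) - theta j (2 * (IZR a * PI) - t).

(** Time reversal fixes the centre, where a motion and its reflection have equal velocities;
    matching initial data there is a condition on the angles alone. *)
Lemma symmetric_motion_center (a : Z) (b : body -> Z) (theta : body -> R -> R) :
  spin_spin_solution P r f theta ->
  symmetric_motion a b theta <->
  (forall j, theta j (IZR a * PI) = IZR (b j) * (PI / 2)).
Proof.
  intros H. split.
  - intros S j. specialize (S j (IZR a * PI)).
    replace (2 * (IZR a * PI) - IZR a * PI) with (IZR a * PI) in S by ring. lra.
  - intros C j t. pose proof (motion_of_solution _ H) as Hm.
    apply (motion_unique _ _ _ _ (IZR a * PI) Hm (motion_reflect a b _ _ Hm)).
    intros i. replace (2 * (IZR a * PI) - IZR a * PI) with (IZR a * PI) by ring.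
    rewrite C. split; ring.
Qed.

Lemma has_symmetric_orbit_iff (theta : body -> R -> R) :
  spin_spin_solution P r f theta ->
  has_symmetric_orbit P r f theta <-> exists a b, symmetric_motion a b theta.
Proof.
  intros H. pose proof (motion_of_solution _ H) as Hm.
  unfold has_symmetric_orbit, symmetric_orbit.
  split; intros (a & b & S); exists a, b.
  - assert (O : orbit P r f (phase_point P theta 0)
      (reversor (IZR a * PI) (fun j => IZR (b j) * (PI / 2)) (phase_point P theta 0))).
    { apply S. eexists. split; [| reflexivity].
      apply orbit_phase_point; [easy | now exists 0]. }
    apply orbit_phase_point in O as [s O]; [| easy].
    injection O as Os X1 X2 X3 X4.
    destruct hP as (_ & _ & _ & _ & hC & _).
    apply Rmult_eq_reg_l in X3, X4; try (pose proof (hC E1); pose proof (hC E2); lra).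
    rewrite Rminus_0_r in Os. subst s.
    intros j t.
    apply (motion_unique _ _ _ _ 0 Hm (motion_reflect a b _ _ Hm)).
    rewrite Rminus_0_r. intros []; split; lra.
  - assert (V : forall j t, Derive (theta j) t = Derive (theta j) (2 * (IZR a * PI) - t)).
    { intros j t.
      pose proof (motion_reflect a b _ _ Hm) as Hr.
      rewrite <- (motion_velocity _ _ Hr). apply Derive_ext. intros s. apply S. }
    assert (E : forall s,
      reversor (IZR a * PI) (fun j => IZR (b j) * (PI / 2)) (phase_point P theta s)
      = phase_point P theta (2 * (IZR a * PI) - s)).
    { intros s. unfold reversor, phase_point. rewrite <- !V.
      rewrite (S E1 s), (S E2 s). repeat f_equal; ring. }
    intros y. rewrite orbit_phase_point by easy. split.
    + intros (z & Hz & ->). apply orbit_phase_point in Hz as [s ->]; [| easy].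
      rewrite E. now eexists.
    + intros [s ->]. exists (phase_point P theta (2 * (IZR a * PI) - s)). split.
      * apply orbit_phase_point; [easy | now eexists].
      * rewrite E. f_equal. ring.
Qed.

(** * Composition of reflections and translations *)

(** Common form of both resonances: the standard one is [c = 2 m], the balanced one [n = 1] and
    [c = m]. *)
Definition translation_symmetric (n : Z) (c : body -> Z)
    (theta : body -> R -> R) : Prop :=
  forall j t, theta j (t + 2 * (IZR n * PI)) = theta j t + IZR (c j) * PI.

(** Two reflections compose to a translation by twice the displacement between their centres, in
    time and in angle. *)
Lemma symmetric_motion_compose (a a' : Z) (b b' : body -> Z)
    (theta : body -> R -> R) :
  symmetric_motion a b theta -> symmetric_motion a' b' theta ->
  translation_symmetric (a' - a) (fun j => (b' j - b j)%Z) theta.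
Proof.
  intros S S' j t. rewrite (S' j), (S j t), !minus_IZR.
  replace (2 * (IZR a' * PI) - (t + 2 * ((IZR a' - IZR a) * PI)))
    with (2 * (IZR a * PI) - t) by ring.
  field.
Qed.

(** A reflection followed by a translation is a reflection whose centre is displaced by half the
    translation. *)
Lemma symmetric_motion_translate (a n : Z) (b c : body -> Z)
    (theta : body -> R -> R) :
  symmetric_motion a b theta -> translation_symmetric n c theta ->
  symmetric_motion (a + n) (fun j => (b j + c j)%Z) theta.
Proof.
  intros S T j t. rewrite (S j t), !plus_IZR.
  replace (2 * ((IZR a + IZR n) * PI) - t)
    with (2 * (IZR a * PI) - t + 2 * (IZR n * PI)) by ring.
  rewrite T. field.
Qed.

Lemma translation_symmetric_iterate (n : Z) (c : body -> Z)
    (theta : body -> R -> R) (k : Z) :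
  translation_symmetric n c theta ->
  translation_symmetric (k * n) (fun j => (k * c j)%Z) theta.
Proof.
  intros T. induction k as [| k IH | k IH] using Z.peano_ind; intros j t.
  - simpl. rewrite Rmult_0_l, Rmult_0_r, Rplus_0_r. ring.
  - replace (t + 2 * (IZR (Z.succ k * n) * PI))
      with (t + 2 * (IZR (k * n) * PI) + 2 * (IZR n * PI))
      by (rewrite !mult_IZR, succ_IZR; ring).
    rewrite T, IH, !mult_IZR, succ_IZR. ring.
  (* For the predecessor, one period is added to both sides to return to the case [k]. *)
  - apply (Rplus_eq_reg_r (IZR (c j) * PI)). rewrite <- T.
    replace (t + 2 * (IZR (Z.pred k * n) * PI) + 2 * (IZR n * PI))
      with (t + 2 * (IZR (k * n) * PI))
      by (unfold Z.pred; rewrite !mult_IZR, plus_IZR; ring).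
    rewrite IH. unfold Z.pred. rewrite !mult_IZR, plus_IZR. ring.
Qed.

Lemma standard_resonance_iff (m : body -> Z) (n : Z) (theta : body -> R -> R) :
  standard_resonance m (fun _ => n) theta <->
  translation_symmetric n (fun j => (2 * m j)%Z) theta.
Proof.
  split; intros H j t; specialize (H j t).
  - replace (2 * (IZR n * PI)) with (2 * PI * IZR n) by ring.
    rewrite H, mult_IZR. ring.
  - replace (2 * PI * IZR n) with (2 * (IZR n * PI)) by ring.
    rewrite H, mult_IZR. ring.
Qed.

Lemma balanced_resonance_iff (m : body -> Z) (theta : body -> R -> R) :
  balanced_resonance m theta <-> translation_symmetric 1 m theta.
Proof.
  split; intros H j t; specialize (H j t).
  - now rewrite Rmult_1_l.
  - now rewrite Rmult_1_l in H.
Qed.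

(** * Effect of the identifications *)

Lemma identified_sym (theta theta' : body -> R -> R) :
  identified theta theta' -> identified theta' theta.
Proof.
  intros (l & k & H). exists (- l)%Z, (fun j => (- k j)%Z). intros j t.
  rewrite H, !opp_IZR.
  replace (t + 2 * PI * - IZR l + 2 * PI * IZR l) with t by ring. ring.
Qed.

Lemma translation_symmetric_identified (n : Z) (c : body -> Z)
    (theta theta' : body -> R -> R) :
  identified theta theta' ->
  translation_symmetric n c theta -> translation_symmetric n c theta'.
Proof.
  intros (l & k & H) T j t. rewrite !H.
  replace (t + 2 * (IZR n * PI) + 2 * PI * IZR l)
    with (t + 2 * PI * IZR l + 2 * (IZR n * PI)) by ring.
  rewrite T. ring.
Qed.

(** Both indices move by even amounts, so they can be reduced to 0 or 1; this is the source of the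
    finite lists of [alpha] and [beta]. *)
Lemma symmetric_motion_identified (a l : Z) (b k : body -> Z)
    (theta theta' : body -> R -> R) :
  (forall j t, theta' j t = theta j (t + 2 * PI * IZR l) + IZR (k j) * PI) ->
  symmetric_motion a b theta ->
  symmetric_motion (a - 2 * l) (fun j => (b j + 2 * k j)%Z) theta'.
Proof.
  intros H S j t. rewrite !H, (S j), minus_IZR, plus_IZR, !mult_IZR.
  replace (2 * ((IZR a - 2 * IZR l) * PI) - t + 2 * PI * IZR l)
    with (2 * (IZR a * PI) - (t + 2 * PI * IZR l)) by ring.
  field.
Qed.

(** The shift is a composition of two reflections, about time 0 and about time [- l PI], so
    [motion_reflect] already covers it. *)
Lemma solution_shift (l : Z) (k : body -> Z) (theta : body -> R -> R) :
  spin_spin_solution P r f theta ->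
  spin_spin_solution P r f
    (fun j t => theta j (t + 2 * PI * IZR l) + IZR (k j) * PI).
Proof.
  intros H.
  apply (solution_ext (fun j t =>
    2 * (IZR (k j) * (PI / 2)) -
    (2 * (IZR 0 * (PI / 2)) -
     theta j (2 * (IZR 0 * PI) - (2 * (IZR (- l) * PI) - t))))).
  - intros j t. rewrite opp_IZR.
    replace (2 * (0 * PI) - (2 * (- IZR l * PI) - t)) with (t + 2 * PI * IZR l)
      by ring.
    field.
  - exact (solution_of_motion _ _
      (motion_reflect (- l) k _ _
        (motion_reflect 0 (fun _ => 0%Z) _ _ (motion_of_solution _ H)))).
Qed.

(** * Boundary conditions as pairs of symmetries *)

Lemma half_turn_multiples (beta : body -> R) :
  (forall j, beta j = 0 \/ beta j = PI / 2) ->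
  exists b : body -> Z, forall j, beta j = IZR (b j) * (PI / 2).
Proof.
  intros H.
  assert (Hj : forall j, exists z, beta j = IZR z * (PI / 2)).
  { intros j. destruct (H j) as [-> | ->]; [exists 0%Z | exists 1%Z]; ring. }
  destruct (Hj E1) as [z1 H1], (Hj E2) as [z2 H2].
  exists (fun j => match j with E1 => z1 | E2 => z2 end). now intros [].
Qed.

Lemma mod2_half_turn (b : Z) :
  IZR (b mod 2) * (PI / 2) = 0 \/ IZR (b mod 2) * (PI / 2) = PI / 2.
Proof.
  assert (Hb : (b mod 2 = 0 \/ b mod 2 = 1)%Z)
    by (pose proof (Z.mod_pos_bound b 2); lia).
  destruct Hb as [-> | ->]; [left | right]; ring.
Qed.

Lemma has_symmetric_orbit_identified (theta theta' : body -> R -> R) :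
  spin_spin_solution P r f theta -> spin_spin_solution P r f theta' ->
  identified theta theta' ->
  has_symmetric_orbit P r f theta -> has_symmetric_orbit P r f theta'.
Proof.
  intros H H' (l & k & E) S.
  apply has_symmetric_orbit_iff in S as (a & b & S); [| easy].
  apply has_symmetric_orbit_iff; [easy |].
  eexists _, _. exact (symmetric_motion_identified _ l _ k _ _ E S).
Qed.

Lemma dirichlet_symmetric (m : body -> Z) (n : Z) (alpha : R) (beta : body -> R)
    (theta : body -> R -> R) :
  spin_spin_solution P r f theta ->
  alpha = 0 \/ alpha = PI ->
  (forall j, beta j = 0 \/ beta j = PI / 2) ->
  dirichlet m n alpha beta theta ->
  exists a b, alpha = IZR a * PI /\ (forall j, beta j = IZR (b j) * (PI / 2)) /\
    symmetric_motion a b theta /\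
    symmetric_motion (a + n) (fun j => (b j + 2 * m j)%Z) theta.
Proof.
  intros H Ha Hb D.
  assert (exists a, alpha = IZR a * PI) as [a ->]
    by (destruct Ha as [-> | ->]; [exists 0%Z | exists 1%Z]; ring).
  destruct (half_turn_multiples beta Hb) as [b Eb].
  exists a, b. repeat split; try easy; apply symmetric_motion_center; try easy;
    intros j; destruct (D j) as [D1 D2].
  - now rewrite D1.
  (* In units of [PI / 2] the increment [m_j PI] counts as [2 m_j]. *)
  - rewrite !plus_IZR, mult_IZR, Rmult_plus_distr_r, D2, Eb. field.
Qed.

Lemma balanced_type_symmetric (m : body -> Z) (beta : body -> R)
    (theta : body -> R -> R) :
  spin_spin_solution P r f theta ->
  (forall j, beta j = 0 \/ beta j = PI / 2) ->
  balanced_type m beta theta ->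
  exists b, (forall j, beta j = IZR (b j) * (PI / 2)) /\
    symmetric_motion 0 b theta /\
    symmetric_motion 1 (fun j => (b j + m j)%Z) theta.
Proof.
  intros H Hb D. destruct (half_turn_multiples beta Hb) as [b Eb].
  exists b. repeat split; try easy; apply symmetric_motion_center; try easy;
    intros j; destruct (D j) as [D1 D2].
  - now rewrite Rmult_0_l, D1.
  - rewrite plus_IZR, Rmult_1_l, D2, Eb. field.
Qed.

Lemma balanced_type_translation (m : body -> Z) (beta : body -> R)
    (theta : body -> R -> R) :
  spin_spin_solution P r f theta ->
  (forall j, beta j = 0 \/ beta j = PI / 2) ->
  balanced_type m beta theta -> translation_symmetric 1 m theta.
Proof.
  intros H Hb D.
  destruct (balanced_type_symmetric m beta theta H Hb D) as (b & _ & S & S').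
  intros j t. pose proof (symmetric_motion_compose _ _ _ _ _ S S' j t) as T.
  change (1 - 0)%Z with 1%Z in T. rewrite T.
  do 3 f_equal. ring.
Qed.

(** * Classification of symmetric resonances *)

Lemma standard_resonance_dirichlet (m : body -> Z) (n : Z)
    (theta : body -> R -> R) :
  spin_spin_solution P r f theta ->
  (has_symmetric_orbit P r f theta /\ standard_resonance m (fun _ => n) theta)
  <->
  (exists theta' : body -> R -> R,
     spin_spin_solution P r f theta' /\
     identified theta theta' /\
     exists (alpha : R) (beta : body -> R),
       (alpha = 0 \/ alpha = PI) /\
       (forall j, beta j = 0 \/ beta j = PI / 2) /\
       dirichlet m n alpha beta theta').
Proof.
  intros H. rewrite has_symmetric_orbit_iff, standard_resonance_iff by easy.
  split.
  - intros [(a & b & S) T].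
    (* These shifts replace [a] and [b j] by their remainders modulo 2. *)
    set (l := (a / 2)%Z). set (k := fun j => (- (b j / 2))%Z).
    set (theta' := fun j t => theta j (t + 2 * PI * IZR l) + IZR (k j) * PI).
    assert (H' : spin_spin_solution P r f theta') by now apply solution_shift.
    assert (I : identified theta theta') by now exists l, k.
    assert (S' : symmetric_motion (a mod 2) (fun j => (b j mod 2)%Z) theta').
    { pose proof (symmetric_motion_identified a l b k theta theta'
        (fun _ _ => eq_refl) S) as S'.
      rewrite Z.mod_eq by lia. intros j t. rewrite (S' j t), Z.mod_eq by lia.
      unfold k. do 4 f_equal. ring. }
    (* Composing with the resonance gives the symmetry about the other endpoint, hence the second
       Dirichlet condition. *)
    pose proof (symmetric_motion_translate _ _ _ _ _ S'
      (translation_symmetric_identified _ _ _ _ I T)) as S2.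
    exists theta'. split; [easy |]. split; [easy |].
    exists (IZR (a mod 2) * PI), (fun j => IZR (b j mod 2) * (PI / 2)).
    split; [| split].
    + assert (Ha : (a mod 2 = 0 \/ a mod 2 = 1)%Z)
        by (pose proof (Z.mod_pos_bound a 2); lia).
      destruct Ha as [-> | ->]; [left | right]; ring.
    + intros j. apply mod2_half_turn.
    + intros j. split.
      * exact (proj1 (symmetric_motion_center _ _ _ H') S' j).
      * rewrite <- Rmult_plus_distr_r, <- plus_IZR.
        pose proof (proj1 (symmetric_motion_center _ _ _ H') S2 j) as V.
        rewrite V, plus_IZR, mult_IZR. field.
  - intros (theta' & H' & I & alpha & beta & Ha & Hb & D).
    destruct (dirichlet_symmetric m n alpha beta theta' H' Ha Hb D)
      as (a & b & _ & _ & S & S2).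
    apply identified_sym in I. split.
    + apply has_symmetric_orbit_iff; [easy |].
      apply (has_symmetric_orbit_identified theta'); try easy.
      apply has_symmetric_orbit_iff; [easy | now exists a, b].
    + apply (translation_symmetric_identified _ _ theta'); [easy |].
      intros j t. pose proof (symmetric_motion_compose _ _ _ _ _ S S2 j t) as T.
      replace (a + n - a)%Z with n in T by ring. rewrite T.
      do 3 f_equal. ring.
Qed.

(** The balanced relation translates time by [2 PI], which displaces a centre by [PI]. Every centre
    can thus be brought to time 0, leaving four types instead of eight combinations. *)
Lemma balanced_resonance_type (m : body -> Z) (theta : body -> R -> R) :
  spin_spin_solution P r f theta ->
  (has_symmetric_orbit P r f theta /\ balanced_resonance m theta)
  <->
  (exists theta' : body -> R -> R,
     spin_spin_solution P r f theta' /\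
     identified theta theta' /\
     exists beta : body -> R,
       (forall j, beta j = 0 \/ beta j = PI / 2) /\
       balanced_type m beta theta').
Proof.
  intros H. rewrite has_symmetric_orbit_iff, balanced_resonance_iff by easy.
  split.
  - intros [(a & b & S) T].
    pose proof (symmetric_motion_translate _ _ _ _ _ S
      (translation_symmetric_iterate _ _ _ (- a) T)) as S0.
    replace (a + - a * 1)%Z with 0%Z in S0 by ring.
    set (b0 := fun j => (b j + - a * m j)%Z) in S0.
    set (k := fun j => (- (b0 j / 2))%Z).
    (* The centre is already at 0, so only the angles need shifting. *)
    set (theta' := fun j t => theta j (t + 2 * PI * IZR 0) + IZR (k j) * PI).
    assert (H' : spin_spin_solution P r f theta') by now apply solution_shift.
    assert (I : identified theta theta') by now exists 0%Z, k.
    assert (S' : symmetric_motion 0 (fun j => (b0 j mod 2)%Z) theta').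
    { pose proof (symmetric_motion_identified 0 0 b0 k theta theta'
        (fun _ _ => eq_refl) S0) as S'.
      intros j t. rewrite (S' j t), Z.mod_eq by lia.
      unfold k. do 4 f_equal. ring. }
    pose proof (symmetric_motion_translate _ _ _ _ _ S'
      (translation_symmetric_identified _ _ _ _ I T)) as S2.
    exists theta'. split; [easy |]. split; [easy |].
    exists (fun j => IZR (b0 j mod 2) * (PI / 2)). split.
    + intros j. apply mod2_half_turn.
    + intros j. split.
      * rewrite <- (Rmult_0_l PI).
        exact (proj1 (symmetric_motion_center _ _ _ H') S' j).
      * pose proof (proj1 (symmetric_motion_center _ _ _ H') S2 j) as V.
        simpl in V. rewrite Rmult_1_l in V.
        rewrite V, plus_IZR. field.
  - intros (theta' & H' & I & beta & Hb & D).
    destruct (balanced_type_symmetric m beta theta' H' Hb D)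
      as (b & _ & S & _).
    apply identified_sym in I. split.
    + apply has_symmetric_orbit_iff; [easy |].
      apply (has_symmetric_orbit_identified theta'); try easy.
      apply has_symmetric_orbit_iff; [easy | now exists 0%Z, b].
    + apply (translation_symmetric_identified _ _ theta'); [easy |].
      now apply (balanced_type_translation m beta).
Qed.

(** By resonance a time shift by [2 PI l] adds [l m_j PI] to the angle, so an identification changes
    the value at time 0 by a multiple of [PI], whereas 0 and [PI / 2] differ by half of [PI]. *)
Lemma balanced_types_not_identified (m : body -> Z)
    (theta theta' : body -> R -> R) (beta beta' : body -> R) :
  spin_spin_solution P r f theta ->
  (forall j, beta j = 0 \/ beta j = PI / 2) ->
  (forall j, beta' j = 0 \/ beta' j = PI / 2) ->
  balanced_type m beta theta -> balanced_type m beta' theta' ->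
  (exists j, beta j <> beta' j) -> ~ identified theta theta'.
Proof.
  intros H Hb Hb' D D' [j Hj] (l & k & I).
  pose proof (translation_symmetric_iterate _ _ _ l
    (balanced_type_translation m beta theta H Hb D) j 0) as T.
  destruct (D j) as [D0 _], (D' j) as [D0' _].
  rewrite I in D0'.
  replace (0 + 2 * PI * IZR l) with (0 + 2 * (IZR (l * 1) * PI)) in D0'
    by (rewrite Z.mul_1_r; ring).
  rewrite T, D0, Rplus_assoc, <- Rmult_plus_distr_r, <- plus_IZR in D0'.
  set (z := (l * m j + k j)%Z) in D0'. pose proof PI_RGT_0 as Hpi.
  assert (Hz : beta' j - beta j = IZR z * PI) by lra.
  (* Doubling brings the contradiction to integers: an even number would be 1 or -1. *)
  assert (Hz2 : IZR (2 * z) = 1 \/ IZR (2 * z) = -1).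
  { rewrite mult_IZR. destruct (Hb j) as [E | E], (Hb' j) as [E' | E'].
    - congruence.
    - left. apply (Rmult_eq_reg_r PI); lra.
    - right. apply (Rmult_eq_reg_r PI); lra.
    - congruence. }
  destruct Hz2 as [Hz2 | Hz2]; apply eq_IZR in Hz2; lia.
Qed.

End Kepler.

Theorem proposition10 (P : params) (hP : admissible P)
    (u r f : R -> R) (hK : kepler_orbit P u r f) :
  (forall (m : body -> Z) (n : Z), n <> 0%Z ->
     (forall theta : body -> R -> R, spin_spin_solution P r f theta ->
        (has_symmetric_orbit P r f theta /\
         standard_resonance m (fun _ => n) theta)
        <->
        (exists theta' : body -> R -> R,
           spin_spin_solution P r f theta' /\
           identified theta theta' /\
           exists (alpha : R) (beta : body -> R),
             (alpha = 0 \/ alpha = PI) /\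
             (forall j, beta j = 0 \/ beta j = PI / 2) /\
             dirichlet m n alpha beta theta'))
     /\
     (forall (theta : body -> R -> R) (alpha : R) (beta : body -> R),
        spin_spin_solution P r f theta ->
        (alpha = 0 \/ alpha = PI) ->
        (forall j, beta j = 0 \/ beta j = PI / 2) ->
        dirichlet m n alpha beta theta ->
        forall j t, theta j t = 2 * beta j - theta j (2 * alpha - t)))
  /\
  (forall m : body -> Z,
     (forall theta : body -> R -> R, spin_spin_solution P r f theta ->
        (has_symmetric_orbit P r f theta /\ balanced_resonance m theta)
        <->
        (exists theta' : body -> R -> R,
           spin_spin_solution P r f theta' /\
           identified theta theta' /\
           exists beta : body -> R,
             (forall j, beta j = 0 \/ beta j = PI / 2) /\
             balanced_type m beta theta'))
     /\
     (forall (theta theta' : body -> R -> R) (beta beta' : body -> R),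
        spin_spin_solution P r f theta ->
        spin_spin_solution P r f theta' ->
        (forall j, beta j = 0 \/ beta j = PI / 2) ->
        (forall j, beta' j = 0 \/ beta' j = PI / 2) ->
        balanced_type m beta theta ->
        balanced_type m beta' theta' ->
        (exists j, beta j <> beta' j) ->
        ~ identified theta theta')
     /\
     (forall (theta : body -> R -> R) (beta : body -> R),
        spin_spin_solution P r f theta ->
        (forall j, beta j = 0 \/ beta j = PI / 2) ->
        balanced_type m beta theta ->
        forall j t, theta j t = 2 * beta j - theta j (- t))).
Proof.
  split.
  - intros m n _. split.
    + intros theta. now apply (standard_resonance_dirichlet P u).
    + intros theta alpha beta H Ha Hb D.
      destruct (dirichlet_symmetric P u r f hP hK m n alpha beta theta H Ha Hb D)
        as (a & b & -> & Eb & S & _).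
      intros j t. rewrite Eb. apply S.
  - intros m. split; [| split].
    + intros theta. now apply (balanced_resonance_type P u).
    + intros theta theta' beta beta' H _.
      now apply (balanced_types_not_identified P u r f hP hK).
    + intros theta beta H Hb D.
      destruct (balanced_type_symmetric P u r f hP hK m beta theta H Hb D)
        as (b & Eb & S & _).
      intros j t. rewrite Eb, (S j t). do 3 f_equal. ring.
Qed.
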